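(* Let $(X,r)$ be a finite involutive (non-degenerate, set-theoretic) solution to the Yang--Baxter equation such that all Sylow subgroups of the permutation group $\mathcal{G}(X,r)$ are cyclic. Then $(X,r)$ is a multipermutation solution.
   Context: A solution is a pair $(X,r)$ where $X$ is a non-empty set and $r\colon X\times X\to X\times X$ is a bijective map, written $r(x,y)=(\sigma_x(y),\tau_y(x))$, such that $(r\times\mathrm{id})(\mathrm{id}\times r)(r\times\mathrm{id})=(\mathrm{id}\times r)(r\times\mathrm{id})(\mathrm{id}\times r)$ and all maps $\sigma_x,\tau_x\colon X\to X$ are permutations (non-degeneracy). It is finite if $X$ is finite, and involutive if $r^2=\mathrm{id}$. For an involutive solution, the permutation group $\mathcal{G}(X,r)$ is the subgroup of the group of permutations of $X$ generated by $\{\sigma_x:x\in X\}$. For an involutive solution $(X,r)$, write $x\sim y$ if and only if $\sigma_x=\sigma_y$. This equivalence relation induces a solution $\operatorname{Ret}(X,r)$ on the set $X/{\sim}$, given by $([x],[y])\mapsto([\sigma_x(y)],[\tau_y(x)])$. Define $\operatorname{Ret}^1(X,r)=\operatorname{Ret}(X,r)$ and $\operatorname{Ret}^{n+1}(X,r)=\operatorname{Ret}(\operatorname{Ret}^n(X,r))$ for $n\geq1$. The solution $(X,r)$ is a multipermutation solution if there exists $n$ such that $\operatorname{Ret}^n(X,r)$ has only one element. *)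

(* Defs.v *)
From HB Require Import structures.
From mathcomp Require Import all_boot all_fingroup all_solvable.
From mathcomp Require Import generic_quotient.
Set Implicit Arguments.
Unset Strict Implicit.
Unset Printing Implicit Defensive.

Local Open Scope quotient_scope.

(* r (x, y) = (sigma r x y, tau r y x) *)
Definition sigma (X : Type) (r : X * X -> X * X) (x y : X) : X := (r (x, y)).1.
Definition tau (X : Type) (r : X * X -> X * X) (y x : X) : X := (r (x, y)).2.

(* r x id and id x r on X * X * X = (X * X) * X *)
Definition act12 (X : Type) (r : X * X -> X * X) (t : X * X * X) : X * X * X :=
  let: (x, y, z) := t in (r (x, y), z).
Definition act23 (X : Type) (r : X * X -> X * X) (t : X * X * X) : X * X * X :=
  let: (x, y, z) := t in (x, (r (y, z)).1, (r (y, z)).2).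

Definition braided (X : Type) (r : X * X -> X * X) : Prop :=
  forall t, act12 r (act23 r (act12 r t)) = act23 r (act12 r (act23 r t)).

Definition nondegenerate (X : Type) (r : X * X -> X * X) : Prop :=
  (forall x, bijective (sigma r x)) /\ (forall y, bijective (tau r y)).

Definition is_solution (X : Type) (r : X * X -> X * X) : Prop :=
  [/\ inhabited X, bijective r, braided r & nondegenerate r].

Record finInvSolution := FinInvSolution {
  carrier :> finType;
  smap : carrier * carrier -> carrier * carrier;
  smap_solution : is_solution smap;
  smap_inv : involutive smap
}.

Lemma sigma_inj (S : finInvSolution) (x : S) : injective (sigma (@smap S) x).
Proof. by case: (smap_solution S) => _ _ _ [h _]; apply: bij_inj. Qed.

Lemma tau_inj (S : finInvSolution) (y : S) : injective (tau (@smap S) y).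
Proof. by case: (smap_solution S) => _ _ _ [_ h]; apply: bij_inj. Qed.

Definition sigma_perm (S : finInvSolution) (x : S) : {perm S} :=
  perm (@sigma_inj S x).

Definition perm_group (S : finInvSolution) : {group {perm S}} :=
  <<[set sigma_perm x | x : S]>>%G.

Definition ret_rel (S : finInvSolution) : rel S :=
  fun x y => sigma_perm x == sigma_perm y.

Lemma ret_relP (S : finInvSolution) (x y : S) :
  reflect (sigma (@smap S) x =1 sigma (@smap S) y) (ret_rel x y).
Proof.
apply: (iffP eqP) => [e z | e].
  by move/permP/(_ z): e; rewrite !permE.
by apply/permP => z; rewrite !permE.
Qed.

Lemma ret_rel_equiv (S : finInvSolution) : equiv_class_of (@ret_rel S).
Proof.
split=> [x|x y|y x z]; rewrite /ret_rel.
- exact: eqxx.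
- exact: eq_sym.
- by move=> /eqP ->.
Qed.

Canonical ret_equiv (S : finInvSolution) : equiv_rel S :=
  EquivRelPack (ret_rel_equiv S).

Definition ret_type (S : finInvSolution) : Type := {eq_quot (ret_equiv S)}.
HB.instance Definition _ (S : finInvSolution) := EqQuotient.on (ret_type S).
HB.instance Definition _ (S : finInvSolution) := Countable.on (ret_type S).
HB.instance Definition _ (S : finInvSolution) : isFinite (ret_type S) :=
  CanIsFinite (@reprK _ (ret_type S)).

(* Defined on representatives; ret_mapE shows that the choice is irrelevant. *)
Definition ret_map (S : finInvSolution) (p : ret_type S * ret_type S) :
    ret_type S * ret_type S :=
  (\pi_(ret_type S) (sigma (@smap S) (repr p.1) (repr p.2)),
   \pi_(ret_type S) (tau (@smap S) (repr p.2) (repr p.1))).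

Lemma smapE (S : finInvSolution) (x y : S) :
  smap (x, y) = (sigma (@smap S) x y, tau (@smap S) y x).
Proof. by rewrite /sigma /tau -surjective_pairing. Qed.

Lemma sigma_braid (S : finInvSolution) (x y z : S) :
  sigma (@smap S) (sigma (@smap S) x y) (sigma (@smap S) (tau (@smap S) y x) z)
  = sigma (@smap S) x (sigma (@smap S) y z).
Proof.
case: (smap_solution S) => _ _ /(_ (x, y, z)) + _.
by rewrite /act12 /act23 /= !smapE /= ?smapE /= => -[].
Qed.

(* The diagonal map T x = sigma_x^-1 x satisfies r (x, T x) = (x, T x). *)
Definition diag (S : finInvSolution) (x : S) : S := ((sigma_perm x)^-1)%g x.

Lemma sigma_diag (S : finInvSolution) (x : S) :
  sigma (@smap S) x (diag x) = x.
Proof.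
by have := permKV (sigma_perm x) x; rewrite {1}/sigma_perm permE.
Qed.

Lemma tau_diag (S : finInvSolution) (x : S) :
  tau (@smap S) (diag x) x = diag x.
Proof.
have := smap_inv (x, diag x).
rewrite !smapE sigma_diag => -[e1 _].
by apply: (@sigma_inj S x); rewrite e1 sigma_diag.
Qed.

Lemma diag_inj (S : finInvSolution) : injective (@diag S).
Proof.
move=> x y e; apply: (@tau_inj S (diag x)).
by rewrite tau_diag {2}e tau_diag.
Qed.

Lemma diag_unique (S : finInvSolution) (x y : S) :
  sigma (@smap S) x y = x -> y = diag x.
Proof. by move=> e; apply: (@sigma_inj S x); rewrite e sigma_diag. Qed.

Lemma sigma_diag_tau (S : finInvSolution) (a v : S) :
  sigma (@smap S) a (diag (tau (@smap S) a v)) = diag v.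
Proof.
have := smap_inv (v, a); rewrite (smapE v a) smapE => -[e1 e2].
set y := tau (@smap S) a v in e1 e2 *; set x := sigma (@smap S) v a in e1 e2.
apply: diag_unique.
by rewrite -{1}e1 -{1}e2 sigma_braid sigma_diag e1.
Qed.

Lemma sigma_tau_eq (S : finInvSolution) (x y : S) :
  sigma (@smap S) x =1 sigma (@smap S) y -> tau (@smap S) x =1 tau (@smap S) y.
Proof.
move=> e v; apply: diag_inj; apply: (@sigma_inj S x).
by rewrite sigma_diag_tau e sigma_diag_tau.
Qed.

Lemma ret_rel_sigma (S : finInvSolution) (x x' y y' : S) :
  ret_rel x x' -> ret_rel y y' ->
  ret_rel (sigma (@smap S) x y) (sigma (@smap S) x' y').
Proof.
move=> /ret_relP ex /ret_relP ey; have ty := sigma_tau_eq ey.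
rewrite -ex; apply/ret_relP => w.
have [z <-] : exists z, sigma (@smap S) (tau (@smap S) y x) z = w.
  exists (((sigma_perm (tau (@smap S) y x))^-1)%g w).
  by rewrite -[LHS](permE (@sigma_inj S _)) permKV.
by rewrite sigma_braid ty sigma_braid ey.
Qed.

Lemma ret_rel_tau (S : finInvSolution) (x x' y y' : S) :
  ret_rel x x' -> ret_rel y y' ->
  ret_rel (tau (@smap S) y x) (tau (@smap S) y' x').
Proof.
move=> hx hy; have /ret_relP es := ret_rel_sigma hx hy.
move: hx hy => /ret_relP ex /ret_relP ey.
apply/ret_relP => w; apply: (@sigma_inj S (sigma (@smap S) x y)).
by rewrite sigma_braid es sigma_braid ey ex.
Qed.

Lemma ret_mapE (S : finInvSolution) (x y : S) :
  ret_map (\pi_(ret_type S) x, \pi_(ret_type S) y) =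
  (\pi_(ret_type S) (sigma (@smap S) x y), \pi_(ret_type S) (tau (@smap S) y x)).
Proof.
have rP (z : S) : ret_rel (repr (\pi_(ret_type S) z)) z.
  by apply/(@eqmodP S (ret_equiv S)); rewrite reprK.
rewrite /ret_map; congr pair; apply/(@eqmodP S (ret_equiv S)).
  exact: ret_rel_sigma (rP x) (rP y).
exact: ret_rel_tau (rP x) (rP y).
Qed.

Lemma ret_map_inv (S : finInvSolution) : involutive (@ret_map S).
Proof.
case=> a b; rewrite -[a]reprK -[b]reprK; move: (repr a) (repr b) => x y.
rewrite (ret_mapE x y) ret_mapE.
by have := smap_inv (x, y); rewrite smapE smapE => -[-> ->].
Qed.

Lemma ret_map_solution (S : finInvSolution) : is_solution (@ret_map S).
Proof.
case: (smap_solution S) => -[x0] _ brS [bs bt].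
split.
- exact: (inhabits (\pi_(ret_type S) x0)).
- exact: inv_bij (@ret_map_inv S).
- pose p := \pi_(ret_type S).
  have pS a : exists x, a = p x by exists (repr a); rewrite /p reprK.
  have a12 u v w : act12 (@ret_map S) (p u, p v, p w) =
      (p (sigma (@smap S) u v), p (tau (@smap S) v u), p w).
    by rewrite /act12 ret_mapE.
  have a23 u v w : act23 (@ret_map S) (p u, p v, p w) =
      (p u, p (sigma (@smap S) v w), p (tau (@smap S) w v)).
    by rewrite /act23 ret_mapE.
  case=> -[a b] c; have [x ->] := pS a; have [y ->] := pS b.
  have [z ->] := pS c; rewrite (a12 x y z) a23 a12 (a23 x y z) a12 a23.
  have := brS (x, y, z).
  rewrite /act12 /act23 /= !smapE /= ?smapE /= => -[e1 e2 e3].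
  by rewrite e1 e2 e3.
- split=> a; rewrite -[a]reprK.
    have [g gK Kg] := bs (repr a).
    have h : cancel (fun b : ret_type S => \pi_(ret_type S) (g (repr b)))
        (sigma (@ret_map S) (\pi_(ret_type S) (repr a))).
      by move=> b; rewrite /sigma ret_mapE /= Kg reprK.
    exact: (Bijective (@canF_sym (ret_type S) _ _ h) h).
  have [g gK Kg] := bt (repr a).
  have h : cancel (fun b : ret_type S => \pi_(ret_type S) (g (repr b)))
      (tau (@ret_map S) (\pi_(ret_type S) (repr a))).
    by move=> b; rewrite /tau ret_mapE /= Kg reprK.
  exact: (Bijective (@canF_sym (ret_type S) _ _ h) h).
Qed.

Definition Ret (S : finInvSolution) : finInvSolution :=
  FinInvSolution (@ret_map_solution S) (@ret_map_inv S).

Definition multipermutation (S : finInvSolution) : Prop :=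
  exists n : nat, 0 < n /\ #|iter n Ret S| = 1.

(* Main.v *)
Require Import Defs.
From mathcomp Require Import all_boot all_fingroup all_solvable.
From mathcomp Require Import ssralg generic_quotient.

(** It suffices that a solution with more than one point, whose permutation
    group G has cyclic Sylow subgroups, has two points with the same
    permutation: its retraction is then smaller, and the permutation group of
    the retraction is a quotient of G ([Zgroup_Ret]), so induction applies.

    The group G carries a second, commutative group law which together with
    composition makes it a left brace.  Rather than as an operation, this
    addition is used through its translations: the maps
    g |-> g o sigma_(g^-1 x) of G to itself commute, generate an abelian group A
    that is regular on G, and composition with h on the left conjugates the
    translation of x into that of h x ([shift_permJ]); since products of
    permutations compose from left to right, it is written as right
    multiplication by h.  If c in G is such that composition with c centralizes
    A, then x and c x have the same translation, hence the same permutation.  So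
    two points are identified as soon as some c <> 1 has this property, that is,
    as soon as the socle of the brace G is not trivial.

    A nontrivial group with cyclic Sylow subgroups has a nontrivial normal Sylow
    p-subgroup ([Zgroup_normal_Sylow]), by Burnside's transfer argument at the
    smallest prime divisor of the order.  A nontrivial normal abelian Sylow
    p-subgroup P meets the socle outside 1
    ([normal_abelian_Sylow_meets_socle]).  Indeed P is also the additive Sylow
    p-subgroup, so P acts on a p-group and fixes some c <> 1 in it;
    commutativity of P turns this into: c acts trivially on P.  Moreover, since
    P is normal, it acts trivially on the additive quotient by P, hence on the
    additive p-complement, which meets P trivially. *)

Set Implicit Arguments.
Unset Strict Implicit.
Unset Printing Implicit Defensive.

Import GroupScope FiniteModule.
Local Open Scope quotient_scope.

(** * A normal Sylow subgroup in groups with cyclic Sylow subgroups *)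

(** The quotient 'N_G(C) / 'C_G(C) acts faithfully on C.  Its order is prime to
    p because it divides the index of P, so it divides p - 1 by the formula for
    the order of the automorphism group of a cyclic p-group; being a divisor of
    #|G| as well, it has no prime factor, since p is the least one. *)
Lemma pdiv_norm_cyclic_cent (gT : finGroupType) (G P C : {group gT}) :
    let p := pdiv #|G| in
  p.-Sylow(G) P -> abelian P -> C \subset P -> cyclic C -> 'N_G(C) \subset 'C(C).
Proof.
move=> p sylP abP sCP cycC.
have [sPG pP p'iGP] := and3P sylP; have pC := pgroupS sCP pP.
have [-> | ntC] := eqVneq C 1%G; first by rewrite cents1.
have [p_pr pdvC [m oC]] := pgroup_pdiv pC ntC.
pose D := (conj_aut C @* 'N_G(C))%G.
have sPC : P \subset 'C(C) by rewrite (sub_abelian_cent2 abP).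
have sPN : P \subset 'N_G(C) by rewrite subsetI sPG cents_norm.
have DdvG : #|D| %| #|G : P|.
  have P1 : conj_aut C @* P = 1.
    by apply/trivgP; rewrite sub_morphim_pre ?cents_norm // -kerE ker_conj_aut.
  rewrite -indexg1 -P1.
  apply: dvdn_trans (index_morphim _ _) (indexSg _ _) => //.
    by rewrite subIset // subsetIr.
  by rewrite subsetIl.
have DdvA : #|D| %| p.-1 * p ^ m.
  rewrite -(totient_pfactor p_pr (ltn0Sn m)) -oC -card_Aut_cyclic //.
  by rewrite cardSg ?Aut_conj_aut.
have p'D : coprime #|D| p.
  by rewrite coprime_sym prime_coprime // -p'natE // (pnat_dvd DdvG).
rewrite Gauss_dvdl ?coprimeXr // in DdvA.
suff D1 : D \subset [1].
  by move: D1; rewrite sub_morphim_pre ?subsetIr // -kerE ker_conj_aut.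
rewrite subG1 trivg_card_le1 leqNgt; apply/negP => ltD.
have rp : prime (pdiv #|D|) by rewrite pdiv_prime.
have : pdiv #|D| <= p.-1.
  apply: dvdn_leq (dvdn_trans (pdiv_dvd _) DdvA).
  by rewrite -ltnS prednK ?prime_gt1 ?prime_gt0.
rewrite leqNgt prednK ?prime_gt0 //.
have -> // : p <= pdiv #|D|.
rewrite pdiv_min_dvd ?prime_gt1 //.
by rewrite (dvdn_trans (pdiv_dvd _)) // (dvdn_trans DdvG) // dvdn_indexg.
Qed.

(** Each factor of the cycle expansion of the transfer is a conjugate, lying in
    P, of a power h of g.  As P is cyclic, h and this conjugate generate the
    same subgroup C, so the conjugating element normalizes C, hence centralizes it:
    the conjugate is h itself. *)
Lemma transfer_cyclic_Sylow (gT : finGroupType) (G P : {group gT})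
    (abP : abelian (idm P @* P)) :
  (pdiv #|G|).-Sylow(G) P -> cyclic P ->
  {in P, forall g, transfer G abP g = (fmod abP g *+ #|G : P|)%R}.
Proof.
move=> sylP cycP g Pg; have sPG := pHall_sub sylP.
have Gg := subsetP sPG g Pg.
have trX := transversalP (rcosets_cycle_partition sPG Gg).
set X := transversal _ _ in trX.
rewrite (transfer_cycle_expansion sPG abP Gg trX).
rewrite -(sum_index_rcosets_cycle sPG Gg trX) -GRing.sumrMnr.
apply: eq_bigr => x Xx; set n := #|_ : _|.
have Gx : x \in G := subsetP (transversal_sub trX) x Xx.
have Pgn : g ^+ n \in P by rewrite groupX.
have Pgnx : (g ^+ n) ^ x^-1 \in P.
  by rewrite conjgE invgK mulgA -mem_rcoset mulg_exp_card_rcosets.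
have -> : (g ^+ n) ^ x^-1 = g ^+ n.
  have nCx : x^-1 \in 'N_G(<[g ^+ n]>).
    have/eqP eqC : <[(g ^+ n) ^ x^-1]> == <[g ^+ n]>.
      rewrite (eq_subG_cyclic cycP) ?cycle_subG //.
      by rewrite [X in X == _]orderJ.
    by rewrite inE groupV Gx inE -cycleJ eqC subxx.
  have sgP : <[g ^+ n]> \subset P by rewrite cycle_subG.
  have sNC := pdiv_norm_cyclic_cent sylP (cyclic_abelian cycP) sgP
    (cycle_cyclic _).
  have/centP/(_ _ (cycle_id _)) cxg := subsetP sNC _ nCx.
  by rewrite /conjg -cxg mulKg.
have imPg : g \in idm P @* P by rewrite morphim_idm.
exact: (fmodX abP n imPg).
Qed.

(** The complement is the kernel of the transfer into P, which by the previous
    lemma is injective on P since #|G : P| is prime to p. *)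
Lemma Burnside_pdiv_complement (gT : finGroupType) (G P : {group gT}) :
    let p := pdiv #|G| in
  p.-Sylow(G) P -> cyclic P -> exists2 K : {group gT}, K <| G & p^'.-Hall(G) K.
Proof.
move=> p sylP cycP; have [sPG pP p'iGP] := and3P sylP.
have abP : abelian (idm P @* P) by rewrite morphim_idm // cyclic_abelian.
pose K := ('ker (transfer_morphism G abP))%G; exists K; first exact: ker_normal.
have tiKP : K :&: P = 1.
  apply/trivgP/subsetP => g /setIP[Kg Pg]; rewrite inE.
  have imPg : g \in idm P @* P by rewrite morphim_idm.
  have := mker Kg; rewrite /= (transfer_cyclic_Sylow abP sylP cycP Pg).
  rewrite -(fmodX abP _ imPg) => /(congr1 fmval).
  rewrite (fmodK abP) ?groupX //= => gm1.
  by rewrite -(expgK (pnat_coprime pP p'iGP) Pg) gm1 expg1n eqxx.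
have p'K : p^'.-group K.
  have := card_Hall (Sylow_setI_normal (ker_normal _ : K <| G) sylP).
  by rewrite /= tiKP cards1 => /esym/eqP; rewrite partn_eq1 ?cardG_gt0.
apply/and3P; split=> //; first exact: subsetIl.
rewrite pnatNK; apply: pnat_dvd pP.
have -> : #|G : K| = #|transfer_morphism G abP @* G|.
  by rewrite card_morphim setIid.
rewrite -(card_injm (f := fmval_morphism abP)) ?subsetT //.
  apply: cardSg; apply/subsetP => _ /morphimP[u _ _ ->].
  by have : val u \in idm P @* P := fmodP u; rewrite morphim_idm.
by apply/injmP=> u v _ _ /val_inj.
Qed.

(** By induction: the normal complement K of a Sylow subgroup at the smallest
    prime has, unless trivial, a normal Sylow subgroup, which is characteristic
    in K and a Sylow subgroup of G because K is a Hall subgroup. *)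
Lemma Zgroup_normal_Sylow (gT : finGroupType) (G : {group gT}) :
  Zgroup G -> G :!=: 1 ->
  exists2 p, p \in \pi(G) & p.-Sylow(G) 'O_p(G).
Proof.
have [n] := ubnP #|G|; elim: n G => // n IHn G /ltnSE-leGn ZgG ntG.
have p_pr : prime (pdiv #|G|) by rewrite pdiv_prime // cardG_gt1.
have [P sylP] := Sylow_exists (pdiv #|G|) G; set p := pdiv #|G| in p_pr sylP.
have cycP : cyclic P by move/forall_inP: ZgG; apply; apply: p_Sylow sylP.
have [K nsKG hallK] := Burnside_pdiv_complement sylP cycP.
have piGp : p \in \pi(G) by rewrite pi_pdiv cardG_gt1.
have [K1 | ntK] := eqVneq K 1%G.
  exists p => //; have pG : p.-group G.
    by have [_ _] := and3P hallK; rewrite K1 indexg1 pnatNK.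
  by rewrite (pcore_pgroup_id pG) /pHall subxx pG indexgg.
have ltKG : #|K| < #|G|.
  rewrite proper_card // properEneq (normal_sub nsKG) andbT.
  apply: contraTneq piGp => eqKG; rewrite -eqKG.
  apply: contraL (pHall_pgroup hallK); rewrite mem_primes => /and3P[_ _ pK].
  by rewrite /pgroup p'natE // negbK.
have ZgK := ZgroupS (normal_sub nsKG) ZgG.
have [q piKq sylQ] := IHn K (leq_trans ltKG leGn) ZgK ntK.
exists q; first exact: (piSg (normal_sub nsKG)).
have p'q : q \in p^'.
  exact: pnatPpi (pHall_pgroup hallK) piKq.
have sylQG : q.-Sylow(G) 'O_q(K) by apply: subHall_Sylow hallK p'q sylQ.
by rewrite (normal_Hall_pcore sylQG) // (gFnormal_trans _ nsKG).
Qed.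

(** * Abelian regular groups normalized by right multiplications *)

Section RegularAbelian.

Variables (gT : finGroupType) (A : {group {perm gT}}).
Hypothesis abA : abelian A.
Hypothesis trA : forall x : gT, exists2 a, a \in A & a 1 = x.

Local Notation R := (actperm 'R).

Hypothesis nAR : forall g : gT, R g \in 'N(A).

Lemma abelian_regular_inj : {in A &, forall a b : {perm gT}, a 1 = b 1 -> a = b}.
Proof.
move=> a b Aa Ab eq1; apply/permP => x; have [c Ac <-] := trA x.
by rewrite -!permM -(centsP abA _ Aa _ Ac) -(centsP abA _ Ab _ Ac) !permM eq1.
Qed.

Lemma abelian_regular_card (D : {set {perm gT}}) :
  D \subset A -> #|[set a (1 : gT) | a : {perm gT} in D]| = #|D|.
Proof.
move=> /subsetP sDA; apply: card_in_imset => a b /sDA Aa /sDA Ab.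
exact: abelian_regular_inj.
Qed.

Lemma regular_mulr (b : {perm gT}) (h g : gT) : b h * g = (b ^ R g) (h * g).
Proof. by rewrite -[h * g](actpermE 'R) permJ actpermE. Qed.

(** In brace terms: an additive subgroup stable under the action of the
    multiplicative group (a left ideal) is a multiplicative subgroup. *)
Lemma orbit_group (D : {group {perm gT}}) :
  (forall g, R g \in 'N(D)) -> group_set [set a (1 : gT) | a : {perm gT} in D].
Proof.
move=> nDR; apply/group_setP; split.
  by apply/imsetP; exists 1; rewrite ?group1 ?perm1.
move=> _ _ /imsetP[a Da ->] /imsetP[b Db ->].
apply/imsetP; exists (b * a ^ R (b 1)); last first.
  by rewrite permM regular_mulr mul1g.
by rewrite groupM // memJ_norm.
Qed.

(** In the brace on gT whose additive translations form A, the elements c such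
    that R c centralizes A are those of the socle. *)
Lemma normal_abelian_Sylow_meets_socle (p : nat) (P : {group gT}) :
    p.-Sylow([set: gT]) P -> P <| [set: gT] -> abelian P -> P :!=: 1 ->
  exists2 c : gT, c != 1 & R c \in 'C(A).
Proof.
move=> sylP nsPG abP ntP; have pP := pHall_pgroup sylP.
pose D := 'O_p(A)%G; pose E := 'O_p^'(A)%G.
have nilA : nilpotent A := abelian_nil abA.
have sylD : p.-Sylow(A) D := nilpotent_pcore_Hall p nilA.
have sDA : D \subset A := pcore_sub _ _.
have sEA : E \subset A := pcore_sub _ _.
have nDR g : R g \in 'N(D) by apply: subsetP (nAR g); apply: gFnorms.
have nER g : R g \in 'N(E) by apply: subsetP (nAR g); apply: gFnorms.
have pD : p.-group D := pcore_pgroup _ _.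
have oA : #|A| = #|[set: gT]|.
  rewrite -(abelian_regular_card (subxx _)); apply: eq_card => x.
  by rewrite inE; apply/imsetP; have [a Aa <-] := trA x; exists a.
have oD : #|D| = #|P| by rewrite (card_Hall sylD) (card_Hall sylP) oA.
(* The additive and the multiplicative Sylow p-subgroups coincide. *)
have defP : [set a (1 : gT) | a : {perm gT} in D] = P.
  apply/eqP; rewrite eqEcard (abelian_regular_card sDA) oD leqnn andbT.
  have := sub_normal_Hall sylP nsPG (subsetT (Group (orbit_group nDR))).
  by rewrite /pgroup /= (abelian_regular_card sDA) => ->.
have D_P a : a \in D -> a 1 \in P by move=> Da; rewrite -defP imset_f.
have P_D x : x \in P -> exists2 a, a \in D & x = a 1.
  by rewrite -defP => /imsetP.
(* The p-group P acts on the p-group D != 1, hence has a fixed point b != 1. *)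
have ntD : D :!=: 1 by rewrite -cardG_gt1 oD cardG_gt1.
have nDRP : R @* P \subset 'N(D).
  by apply/subsetP=> _ /morphimP[g _ _ ->]; apply: nDR.
have pDP : p.-group (D <*> R @* P).
  by rewrite norm_joinEr // pgroupM pD morphim_pgroup.
have nsD : D <| D <*> R @* P by rewrite /normal joing_subl join_subG normG.
have /trivgPn[b /setIP[Db /centerP[_ cb]] ntb] :=
  meet_center_nil (pgroup_nil pDP) nsD ntD.
have cbR g : g \in P -> commute b (R g).
  by move=> Pg; apply: cb; rewrite mem_gen // inE mem_morphim ?inE ?orbT.
have Ab : b \in A := subsetP sDA b Db.
have Pc : b 1 \in P := D_P b Db.
exists (b 1).
  apply: contraNneq ntb => b1; apply/eqP/abelian_regular_inj => //.
  by rewrite b1 perm1.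
set c := b 1.
have memAR (a : {perm gT}) g : a \in A -> a ^ R g \in A.
  by move=> Aa; rewrite memJ_norm.
have mul_c (a : {perm gT}) : a 1 * c = (b * a ^ R c) 1.
  by rewrite permM regular_mulr mul1g.
(* For a in D and g = a 1, the fact that b is fixed by g and that c and g commute
   compares a + b with b + c.a, where c.a is the action of c on a. *)
have cD : R c \in 'C(D).
  apply/centP => a Da; have Aa := subsetP sDA a Da.
  have Pg := D_P a Da.
  have c_mul : c * a 1 = (a * b) 1.
    by rewrite permM regular_mulr mul1g /conjg (cbR _ Pg) mulKg.
  have eq_ab : a * b = b * a ^ R c.
    apply: abelian_regular_inj; [exact: groupM | exact: groupM (memAR _ _ Aa) |].
    exact: etrans (esym c_mul) (etrans (centsP abP _ Pc _ Pg) (mul_c a)).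
  apply/esym/commgP/conjg_fixP; apply: (mulgI b).
  by rewrite -eq_ab (centsP abA _ Aa _ Ab).
(* For a in E and g = a 1, normality of P moves c across g: g c = c' g with c' in
   P, whence c.a - a lies both in E and in D. *)
have cE : R c \in 'C(E).
  apply/centP => a Ea; have Aa := subsetP sEA a Ea.
  have [b' Db' def_b'] : exists2 b', b' \in D & c ^ (a 1)^-1 = b' 1.
    by apply: P_D; rewrite memJ_norm // (subsetP (normal_norm nsPG)) ?inE.
  have Ab' := subsetP sDA b' Db'.
  have eq_ab : b * a ^ R c = a * b' ^ R (a 1).
    apply: abelian_regular_inj;
      [exact: groupM (memAR _ _ Aa) | exact: groupM (memAR _ _ Ab') |].
    have <- : b' 1 * a 1 = (a * b' ^ R (a 1)) 1.
      by rewrite permM regular_mulr mul1g.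
    by rewrite -mul_c -def_b' conjgE invgK mulgA mulgKV.
  apply/esym/commgP; rewrite commgEl.
  have Dx : a^-1 * a ^ R c \in D.
    have -> : a^-1 * a ^ R c = b^-1 * b' ^ R (a 1).
      apply: (mulgI a); apply: (mulgI b); rewrite mulKVg eq_ab.
      by rewrite !mulgA (centsP abA _ Ab _ Aa) mulgK.
    by rewrite groupM ?groupV // memJ_norm.
  have Ex : a^-1 * a ^ R c \in E by rewrite groupM ?groupV // memJ_norm.
  rewrite -in_set1; have /trivgP/subsetP := TI_pcoreC p A A; apply.
  by rewrite inE Dx.
have [_ <- _ _] := dprodP (nilpotent_pcoreC p nilA).
by rewrite centM inE cD cE.
Qed.

End RegularAbelian.

(** * The additive translations of the permutation group *)

Section Translations.

Variable S : finInvSolution.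
Local Notation gT := (subg_of (perm_group S)).
Local Notation R := (actperm 'R).

Lemma sigma_permE (x y : S) : sigma_perm x y = sigma (@smap S) x y.
Proof. by rewrite permE. Qed.

Lemma sigma_perm_in (x : S) : sigma_perm x \in perm_group S.
Proof. by rewrite mem_gen // imset_f. Qed.

Definition sigma_sub (x : S) : gT := Subg (sigma_perm_in x).

(** The braid relation with tau eliminated through involutivity: the defining
    identity of a cycle set. *)
Lemma sigma_cycle_set (x y : S) :
  sigma_perm ((sigma_perm x)^-1 y) * sigma_perm x =
  sigma_perm ((sigma_perm y)^-1 x) * sigma_perm y.
Proof.
set z := (sigma_perm x)^-1 y.
have xz : sigma (@smap S) x z = y by rewrite -sigma_permE permKV.
have -> : (sigma_perm y)^-1 x = tau (@smap S) z x.
  apply: (perm_inj (s := sigma_perm y)); rewrite permKV sigma_permE.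
  by have := smap_inv (x, z); rewrite !smapE xz => -[].
by apply/permP => w; rewrite !permM !sigma_permE -sigma_braid xz.
Qed.

(** Addition of the generator sigma_perm x to g in the brace perm_group S. *)
Definition shift (x : S) (g : gT) : gT := sigma_sub ((sgval g)^-1 x) * g.

(** The point g^-1 x, hence g, is recovered from h = shift x g, since h^-1 x is
    the image of g^-1 x under the diagonal map, which is injective. *)
Lemma shift_inj (x : S) : injective (shift x).
Proof.
move=> g h eq_gh.
have diagE k : (sgval (shift x k))^-1 x = diag ((sgval k)^-1 x).
  by rewrite /= invMg permM.
have eq_x : (sgval g)^-1 x = (sgval h)^-1 x.
  by apply: diag_inj; rewrite -!diagE eq_gh.
by move: eq_gh; rewrite /shift eq_x => /mulgI.
Qed.

Definition shift_perm (x : S) : {perm gT} := perm (@shift_inj x).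

Definition shift_group : {group {perm gT}} := <<[set shift_perm x | x : S]>>%G.

Lemma shift_perm_in (x : S) : shift_perm x \in shift_group.
Proof. by rewrite mem_gen // imset_f. Qed.

Lemma shift_group_abelian : abelian shift_group.
Proof.
rewrite abelian_gen; apply/centsP => _ /imsetP[x _ ->] _ /imsetP[y _ ->].
apply/permP => g; rewrite !permM !permE /shift /= !mulgA !invMg !permM.
by congr (_ * _); apply: val_inj; rewrite /= sigma_cycle_set.
Qed.

Lemma shift_permJ (x : S) (h : gT) : shift_perm x ^ R h = shift_perm (sgval h x).
Proof.
apply/permP => g; rewrite -[g](mulgKV h); move: (g * h^-1) => k.
rewrite -[LHS]regular_mulr.
by rewrite !permE /shift /= -mulgA invMg permM permK.
Qed.

Lemma shift_group_norm (h : gT) : R h \in 'N(shift_group).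
Proof.
apply: (subsetP (norm_gen _)); rewrite inE.
apply/subsetP => _ /imsetP[_ /imsetP[x _ ->] ->].
by rewrite shift_permJ imset_f.
Qed.

(** Transitivity holds because shift x g = s_y * g for x = g y, so every product
    of generators s_y can be built up from 1 one factor at a time. *)
Lemma shift_group_trans (g : gT) :
  exists2 a : {perm gT}, a \in shift_group & a 1 = g.
Proof.
have /gen_prodgP[n [c gen_c def_g]] : sgval g \in perm_group S := subgP g.
suff [a Aa aE] :
    exists2 a : {perm gT}, a \in shift_group & sgval (a 1) = \prod_i c i.
  by exists a => //; apply: val_inj; rewrite /= aE.
elim: n c gen_c {def_g} => [|n IHn] c gen_c.
  by exists 1; rewrite ?group1 // perm1 big_ord0.
have [|a Aa aE] := IHn (fun i => c (lift ord0 i)) _; first by [].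
have /imsetP[y _ cE] := gen_c ord0.
exists (a * shift_perm (sgval (a 1) y)); first by rewrite groupM ?shift_perm_in.
by rewrite permM permE /= permK big_ord_recl -aE cE.
Qed.

(** A socle element c <> 1 moves some point x, and the translations of x and of
    c x agree; evaluating them at 1 gives the permutations of x and c x. *)
Lemma Zgroup_retractable :
  Zgroup (perm_group S) -> 1 < #|S| -> exists x y : S, x != y /\ ret_rel x y.
Proof.
move=> ZG ltS; have [G1 | ntG] := eqVneq (gval (perm_group S)) 1.
  have /card_gt1P[x [y [_ _ xy]]] := ltS; exists x, y; split=> //.
  have s1 (z : S) : sigma_perm z = 1.
    by have := sigma_perm_in z; rewrite G1 => /set1gP.
  by rewrite /ret_rel !s1.
have ZgT : Zgroup [set: gT].
  have : Zgroup (subg (perm_group S) @* perm_group S) := morphim_Zgroup _ ZG.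
  by rewrite im_subg.
have ntT : [set: gT] != 1.
  have : subg (perm_group S) @* perm_group S != 1.
    by rewrite morphim_injm_eq1 ?injm_subg.
  by rewrite im_subg.
have [p pip sylP] := Zgroup_normal_Sylow ZgT ntT.
have cycP : cyclic 'O_p([set: gT]).
  by move/forall_inP: ZgT; apply; apply: p_Sylow sylP.
have ntP : 'O_p([set: gT]) != 1.
  rewrite -cardG_gt1 (card_Hall sylP) p_part.
  have p_pr : prime p by move: pip; rewrite mem_primes => /andP[].
  by rewrite -(expn0 p) ltn_exp2l ?logn_gt0 ?prime_gt1.
have [c ntc cC] := normal_abelian_Sylow_meets_socle shift_group_abelian
  shift_group_trans shift_group_norm sylP (gFnormal _ _) (cyclic_abelian cycP) ntP.
have [x cx] : exists x, sgval c x != x.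
  apply/existsP; apply: contraNT ntc => /existsPn fix_c.
  apply/eqP/val_inj/permP => x.
  by rewrite /= perm1; apply/eqP; rewrite -[_ == _]negbK.
exists (sgval c x), x; split=> //.
have : shift_perm (sgval c x) = shift_perm x.
  rewrite -shift_permJ; apply/conjg_fixP/commgP.
  by apply/esym; apply: (centP cC); apply: shift_perm_in.
move/permP/(_ 1); rewrite !permE /shift !mulg1 !invg1 !perm1.
move=> /(congr1 val) /= e.
by rewrite /ret_rel e.
Qed.

End Translations.

(** * Induction along the retraction *)

Section Retraction.

Variable S : finInvSolution.
Local Notation pi := (\pi_(ret_type S)).

(** The graph of the homomorphism from perm_group S onto perm_group (Ret S) that
    sends sigma_x to sigma_[x]; generating the graph spares the construction of
    the induced permutation for an arbitrary element of perm_group S. *)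
Definition ret_graph : {group {perm S} * {perm Ret S}} :=
  <<[set (sigma_perm x, @sigma_perm (Ret S) (pi x)) | x : S]>>%G.

Lemma ret_graph_compat (w : {perm S} * {perm Ret S}) (x : S) :
  w \in ret_graph -> w.2 (pi x) = pi (w.1 x).
Proof.
pose C : {set {perm S} * {perm Ret S}} :=
  [set w : {perm S} * {perm Ret S} | [forall x, w.2 (pi x) == pi (w.1 x)]].
have CP (u : {perm S} * {perm Ret S}) :
    reflect (forall z, u.2 (pi z) = pi (u.1 z)) (u \in C).
  by rewrite inE; apply: (iffP forallP) => cw z; apply/eqP; apply: cw.
have gC : group_set C.
  apply/group_setP; split; first by apply/CP => z; rewrite !perm1.
  by move=> u v /CP uC /CP vC; apply/CP => z; rewrite /= !permM uC vC.
suff /subsetP sC : ret_graph \subset Group gC by move/sC/CP.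
rewrite gen_subG; apply/subsetP => _ /imsetP[y _ ->]; apply/CP => z /=.
by rewrite 2!permE; exact: (congr1 fst (ret_mapE y z)).
Qed.

(** The first projection of the graph is injective because the second component
    of a pair is determined by the first, the quotient map being onto. *)
Lemma Zgroup_Ret : Zgroup (perm_group S) -> Zgroup (perm_group (Ret S)).
Proof.
move=> ZG.
have im1 : fst @* ret_graph = perm_group S.
  rewrite morphim_gen ?subsetT // morphimEsub ?subsetT // -imset_comp.
  by congr <<_>>; apply: eq_imset.
have im2 : snd @* ret_graph = perm_group (Ret S).
  rewrite morphim_gen ?subsetT // morphimEsub ?subsetT // -imset_comp.
  congr <<_>>; apply/setP => s; apply/imsetP/imsetP => [[x _ ->] | [z _ ->]].
    by exists (pi x).
  by exists (repr z); rewrite //= reprK.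
have inj1 : 'injm (restrm (subsetT ret_graph) fst).
  apply/injmP => u v Gu Gv eq1; have {}eq1 : u.1 = v.1 by [].
  rewrite [u]surjective_pairing [v]surjective_pairing eq1; congr pair.
  apply/permP => z; rewrite -[z]reprK.
  by rewrite (ret_graph_compat _ Gu) (ret_graph_compat _ Gv) eq1.
have Zgraph : Zgroup ret_graph.
  have <- : invm inj1 @* perm_group S = ret_graph.
    have <- : restrm (subsetT ret_graph) fst @* ret_graph = perm_group S.
      by rewrite morphim_restrm setIid.
    exact: morphim_invm.
  exact: morphim_Zgroup.
by rewrite -im2; apply: morphim_Zgroup.
Qed.

Lemma card_Ret_lt : (exists x y : S, x != y /\ ret_rel x y) -> #|Ret S| < #|S|.
Proof.
case=> x [y [xy rxy]].
have injr : injective (repr : Ret S -> S) by apply: can_inj (@reprK _ (ret_type S)).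
rewrite -(card_codom injr) -cardsT -[X in X < _]cardsE.
apply: proper_card; rewrite properEneq subsetT andbT.
apply: contraNneq xy => eqT.
have rK (z : S) : repr (pi z) = z.
  have: z \in [set u in codom (repr : Ret S -> S)] by rewrite eqT inE.
  by rewrite inE => /codomP[w ->]; rewrite reprK.
by rewrite -(rK x) -(rK y) (_ : pi x = pi y) //; apply/(@eqmodP S (ret_equiv S)).
Qed.

End Retraction.

Lemma Zgroup_multipermutation (S : finInvSolution) :
  Zgroup (perm_group S) -> multipermutation S.
Proof.
have [n] := ubnP #|S|; elim: n S => // n IHn S /ltnSE-leSn ZS.
have [ltS | leS] := ltnP 1 #|S|.
  have ltR := card_Ret_lt (Zgroup_retractable ZS ltS).
  have [k [k_gt0 kR]] := IHn _ (leq_trans ltR leSn) (Zgroup_Ret ZS).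
  by exists k.+1; rewrite iterSr.
exists 1%N; split=> //; apply/eqP; rewrite eqn_leq; apply/andP; split.
  apply: leq_trans leS; apply: (leq_card (repr : Ret S -> S)).
  exact: can_inj (@reprK _ (ret_type S)).
have [[x] _ _ _] := smap_solution (Ret S).
by apply/card_gt0P; exists x.
Qed.

Theorem theorem2p5 (S : finInvSolution)
    (cyclicSylow : forall (p : nat) (P : {group {perm S}}),
       prime p -> (p.-Sylow(perm_group S) P)%g -> cyclic P) :
  multipermutation S.
Proof.
apply: Zgroup_multipermutation; apply/forall_inP => P /SylowP[p p_pr sylP].
exact: cyclicSylow p_pr sylP.
Qed.
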